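(* Let $\alpha\in(1,2)$ and let $X$ be symmetric $\alpha$-stable with characteristic function $\varphi(t)=\exp(-|t|^\alpha)$, $t\in\mathbb{R}$. Let $X_n$, $n\ge1$, be compound Poisson random variables with characteristic functions $$\varphi_n(t)=\exp\left(n\left((\varphi(t))^{\frac1n}-1\right)\right),\qquad t\in\mathbb{R}.$$ Then there is a constant $C>0$ depending only on $\alpha$ such that for all $n\ge1$ $$d_K(X_n,X)\le\frac{C}{n^{\frac1\alpha}}.$$
   Context: $d_K(X,Y)=\sup_{x\in\mathbb{R}}|\mathbb{P}(X\le x)-\mathbb{P}(Y\le x)|$ is the Kolmogorov distance. *)

(* Defs.v *)
From HB Require Import structures.
From mathcomp Require Import all_boot all_order all_algebra.
From mathcomp Require Import complex.
From mathcomp Require Import all_classical all_reals all_analysis.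

Set Implicit Arguments.
Unset Strict Implicit.
Unset Printing Implicit Defensive.

Import Order.TTheory GRing.Theory Num.Theory.
Import numFieldNormedType.Exports.

Local Open Scope classical_set_scope.
Local Open Scope ring_scope.
Local Open Scope complex_scope.

(* Both expectations are those of bounded random variables, hence finite. *)
Definition char_fun (R : realType) (d : measure_display) (T : measurableType d)
    (P : probability T R) (X : {RV P >-> R}) (t : R) : R[i] :=
  fine 'E_P[fun w => cos (t * X w)] +i* fine 'E_P[fun w => sin (t * X w)].

(* [X] and [Y] may live on different probability spaces. *)
Definition kolmogorov_dist (R : realType)
    (d : measure_display) (T : measurableType d) (P : probability T R)
    (d' : measure_display) (T' : measurableType d') (P' : probability T' R)
    (X : {RV P >-> R}) (Y : {RV P' >-> R}) : R :=
  sup (range (fun x : R => `|fine (cdf X x) - fine (cdf Y x)|)).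

Definition symmetric_law (R : realType) (mu : probability R R) : Prop :=
  forall A : set R, measurable A -> pushforward mu (fun x : R => - x) A = mu A.

(* If [U] and [V] are independent with law [mu], then [a U + b V] has the law
   of [(a^alpha + b^alpha)^(1/alpha) U + c] for some constant [c]. *)
Definition stable_law (R : realType) (alpha : R) (mu : probability R R) : Prop :=
  forall a b : R, 0 < a -> 0 < b -> exists c : R,
  forall A : set R, measurable A ->
    pushforward (mu \x mu)%E (fun z : R * R => a * z.1 + b * z.2) A
    = pushforward mu
        (fun x : R => (a `^ alpha + b `^ alpha) `^ alpha^-1 * x + c) A.

Definition symmetric_stable (R : realType) (alpha : R)
    (d : measure_display) (T : measurableType d) (P : probability T R)
    (X : {RV P >-> R}) : Prop :=
  symmetric_law (distribution P X) /\ stable_law alpha (distribution P X).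

Fixpoint convolution_pow (R : realType) (nu : probability R R) (k : nat) :
    set R -> \bar R :=
  if k is k'.+1 then
    pushforward (nu \x convolution_pow nu k')%E
      (fun z : R * R => z.1 + z.2)
  else dirac (0 : R).

(* [X] has the law of [Y_1 + ... + Y_N], where [N] is Poisson with parameter
   [rate], the [Y_i] have law [nu], and [N], [Y_1], [Y_2], ... are
   independent. *)
Definition compound_poisson (R : realType)
    (d : measure_display) (T : measurableType d) (P : probability T R)
    (X : {RV P >-> R}) : Prop :=
  exists (rate : R) (nu : probability R R), 0 < rate /\
  forall A : set R, measurable A ->
    distribution P X A
    = (\sum_(0 <= k <oo) (poisson_pmf rate k)%:E * convolution_pow nu k A)%E.

Definition stable_phi (R : realType) (alpha t : R) : R :=
  expR (- (`|t| `^ alpha)).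

(* [stable_phi alpha t] is a positive real number, so that its [n]-th root is
   the real one. *)
Definition stable_phi_n (R : realType) (alpha : R) (n : nat) (t : R) : R :=
  expR (n%:R * (stable_phi alpha t `^ (1 / n%:R) - 1)).

(* Main.v *)
(* Put e = n^(-1/alpha) and g(z) = atan z + z / (1 + z^2).  Both g and the Poisson kernel are Laplace
   transforms,
     g(z) = int_0^oo e^-t (1 + t) sin(t z) / t dt,
     1 / (1 + z^2) = int_0^oo e^-t cos(t z) dt,
   so by Fubini the expectations of g((Y - a)/e) - g((Y - b)/e) and of
   1 / (1 + ((Y - b)/e)^2) are integrals of the characteristic function of Y at
   t/e.  The second term of g cancels the 1/z tail of the arctangent, whence
   |pi/2 sgn z - g(z)| <= 4 / (1 + z^2): the error made when replacing the
   indicator of ]a, b] by the g-increment is again controlled by Poisson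
   kernels, and no Esseen-type argument is needed.  Writing v = t^alpha, the
   characteristic functions at t/e are exp(-n v) and exp(n (exp(-v) - 1)); their
   difference is at most t (6 exp(-t/(4e)) + 2 e), so all the integrals are
   O(e).  Finally a tends to -oo. *)
Require Import Defs.
From HB Require Import structures.
From mathcomp Require Import all_boot all_order all_algebra.
From mathcomp Require Import complex.
From mathcomp Require Import ring lra.
From mathcomp Require Import all_classical all_reals all_analysis.
From mathcomp Require Import measurable_realfun.

Set Implicit Arguments.
Unset Strict Implicit.
Unset Printing Implicit Defensive.

Import Order.TTheory GRing.Theory Num.Theory.
Import numFieldNormedType.Exports.

Local Open Scope classical_set_scope.
Local Open Scope ring_scope.
Local Open Scope complex_scope.

(** * Antiderivatives of Laplace type and their decay at infinity *)

Lemma expRN_1D_le (R : realType) (t : R) : 0 < t -> expR (- t) * (1 + t) <= 4 / t.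
Proof.
move=> t0; rewrite expRN ler_pdivlMr// -mulrA ler_pdivrMl ?expR_gt0//.
(* Squaring [1 + t / 2 <= expR (t / 2)] gives the quadratic growth that absorbs [t * (1 + t)]. *)
have t2 : t = t / 2 + t / 2 by field.
rewrite [in expR t]t2 expRD.
have h := expR_ge1Dx (t / 2).
have u0 : 0 <= 1 + t / 2 by lra.
have := ler_pM u0 u0 h h.
move: (expR _ * expR _) => e; nra.
Qed.

Lemma is_derive1_mulr (R : realType) (f g : R -> R) (t df dg : R) :
  is_derive t 1 f df -> is_derive t 1 g dg ->
  is_derive t 1 (fun u => f u * g u) (f t * dg + g t * df).
Proof. by move=> hf hg; exact: is_deriveM. Qed.

(** The products of [expR (- t)] with affine combinations of this shape are closed under
    differentiation, so antiderivatives of the Laplace kernels are found among them by solving for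
    the coefficients. *)
Lemma laplace_is_derive (R : realType) (p0 q0 p q r s z t : R) :
  is_derive t 1
    (fun t : R => expR (- t) * ((p0 * t + q0) + (p * t + q) * cos (t * z)
       + (r * t + s) * sin (t * z)))
    (expR (- t) * ((p0 - (p0 * t + q0)) + (p - (p * t + q) + z * (r * t + s)) * cos (t * z)
       + (r - (r * t + s) - z * (p * t + q)) * sin (t * z))).
Proof.
have dz : is_derive t 1 (fun t : R => t * z) z.
  have := is_derive1_mulr (is_derive_id t 1) (is_derive_cst z t 1).
  by rewrite mulr0 mulr1 add0r.
have da (a b : R) : is_derive t 1 (fun t : R => a * t + b) a.
  have := is_deriveD (is_derive1_mulr (is_derive_cst a t 1) (is_derive_id t 1))
    (is_derive_cst b t 1).
  by rewrite mulr0 mulr1 !addr0.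
have dc := @is_derive1_comp _ cos (fun t : R => t * z) _ _ _ (is_derive_cos (t * z)) dz.
have ds := @is_derive1_comp _ sin (fun t : R => t * z) _ _ _ (is_derive_sin (t * z)) dz.
have de : is_derive t 1 (fun t : R => expR (- t)) (- expR (- t)).
  have := @is_derive1_comp _ expR -%R _ _ _ (is_derive_expR (- t)) (is_deriveN (is_derive_id t 1)).
  by rewrite mulrN1.
have := is_derive1_mulr de (is_deriveD (is_deriveD (da p0 q0) (is_derive1_mulr (da p q) dc))
  (is_derive1_mulr (da r s) ds)).
move=> /is_derive_eq; apply => /=.
rewrite !fctE; ring.
Qed.

Lemma continuous_id_mulr (R : realType) (z : R) : continuous (fun t : R => t * z).
Proof. by move=> t; apply: cvgMr_tmp; exact: cvg_id. Qed.

Lemma continuous_cos_mulr (R : realType) (z : R) : continuous (fun t : R => cos (t * z)).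
Proof.
move=> t; apply: (@continuous_comp _ _ _ (fun t : R => t * z) cos).
  exact: continuous_id_mulr.
exact: continuous_cos.
Qed.

Lemma continuous_sin_mulr (R : realType) (z : R) : continuous (fun t : R => sin (t * z)).
Proof.
move=> t; apply: (@continuous_comp _ _ _ (fun t : R => t * z) sin).
  exact: continuous_id_mulr.
exact: continuous_sin.
Qed.

Lemma continuous_expRN (R : realType) : continuous (fun t : R => expR (- t)).
Proof.
move=> t; apply: (@continuous_comp _ _ _ (fun t : R => - t) expR).
  exact: opp_continuous.
exact: continuous_expR.
Qed.

Lemma laplace_cvg0 (R : realType) (p0 q0 p q r s z : R) :
  expR (- t) * ((p0 * t + q0) + (p * t + q) * cos (t * z)
       + (r * t + s) * sin (t * z)) @[t --> +oo] --> 0.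
Proof.
pose M := `|p0| + `|q0| + (`|p| + `|q|) + (`|r| + `|s|).
have M0 : 0 <= M by rewrite !addr_ge0.
apply: norm_cvg0.
(* The bracket is at most [M * (1 + t)] because sine and cosine are bounded by 1; [expRN_1D_le] then
   gives [4 * M / t]. *)
apply: (@squeeze_cvgr _ _ _ _ (cst 0) (fun t : R => (4 * M) * t^-1)).
- near=> t.
  have t0 : 0 < t by near: t; exact: nbhs_pinfty_gt.
  rewrite normr_ge0/= normrM ger0_norm ?expR_ge0//.
  apply: (@le_trans _ _ (expR (- t) * (M * (1 + t)))).
    rewrite ler_wpM2l ?expR_ge0//.
    have h (a b c : R) : `|c| <= 1 -> `|(a * t + b) * c| <= (`|a| + `|b|) * (1 + t).
      move=> c1; rewrite normrM -[leRHS]mulr1 ler_pM//.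
      rewrite (le_trans (ler_normD _ _))// normrM (gtr0_norm t0).
      by have := normr_ge0 a; have := normr_ge0 b; nra.
    rewrite (le_trans (ler_normD _ _))// [in leRHS]mulrDl lerD//; last first.
      exact/h/sin_max.
    rewrite (le_trans (ler_normD _ _))// [in leRHS]mulrDl lerD//; last first.
      exact/h/cos_max.
    by have := h p0 q0 1; rewrite mulr1; apply; rewrite normr1.
  have := expRN_1D_le t0.
  move: (expR _ ) => e h.
  by rewrite mulrCA [leRHS]mulrAC [leRHS]mulrC ler_wpM2l.
- exact: cvg_cst.
- rewrite -[X in _ --> X](mulr0 (4 * M)).
  by apply: cvgMl_tmp; apply/gtr0_cvgV0; [exact: nbhs_pinfty_gt|exact: cvg_id].
Unshelve. all: by end_near. Qed.

(** * Integrability criteria for real-valued functions *)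

Lemma integrable_dominated d (T : measurableType d) (R : realType)
    (m : {measure set T -> \bar R}) (D : set T) (f g : T -> R) :
  measurable D -> measurable_fun D f -> (forall x, D x -> `|f x| <= g x) ->
  m.-integrable D (EFin \o g) -> m.-integrable D (EFin \o f).
Proof.
move=> mD mf fg; apply: le_integrable => //; first exact/measurable_EFinP.
by move=> x Dx; rewrite /= lee_fin (le_trans (fg x Dx))// ler_norm.
Qed.

Lemma ge0_integrable_EFin d (T : measurableType d) (R : realType)
    (m : {measure set T -> \bar R}) (D : set T) (f : T -> R) (c : R) :
  measurable D -> measurable_fun D f -> (forall x, D x -> 0 <= f x) ->
  (\int[m]_(x in D) (f x)%:E = c%:E)%E -> m.-integrable D (EFin \o f).
Proof.
move=> mD mf f0 fc; apply/integrableP; split; first exact/measurable_EFinP.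
rewrite (eq_integral (EFin \o f)) ?fc ?ltry// => x; rewrite inE => Dx /=.
by rewrite ger0_norm ?f0.
Qed.

Lemma integrableZl_EFin d (T : measurableType d) (R : realType)
    (m : {measure set T -> \bar R}) (D : set T) (f : T -> R) (c : R) :
  measurable D -> m.-integrable D (EFin \o f) ->
  m.-integrable D (EFin \o (fun x => c * f x)).
Proof. by move=> mD mf; exact: (integrableZl mD c mf). Qed.

Lemma integrableD_EFin d (T : measurableType d) (R : realType)
    (m : {measure set T -> \bar R}) (D : set T) (f g : T -> R) :
  measurable D -> m.-integrable D (EFin \o f) -> m.-integrable D (EFin \o g) ->
  m.-integrable D (EFin \o (fun x => f x + g x)).
Proof. by move=> mD mf mg; exact: (integrableD mD mf mg). Qed.

Lemma integrableB_EFin d (T : measurableType d) (R : realType)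
    (m : {measure set T -> \bar R}) (D : set T) (f g : T -> R) :
  measurable D -> m.-integrable D (EFin \o f) -> m.-integrable D (EFin \o g) ->
  m.-integrable D (EFin \o (fun x => f x - g x)).
Proof. by move=> mD mf mg; exact: (integrableB mD mf mg). Qed.

(** * Laplace transforms of the cosine and exponential integrals *)

Section laplace_transform.
Context {R : realType}.
Local Notation mu := (@lebesgue_measure R).

Lemma continuous_expRN_poly (b : R) : continuous (fun t : R => expR (- t) * (1 + b * t)).
Proof.
move=> t; apply: cvgM; first exact: continuous_expRN.
by apply: cvgD; [exact: cvg_cst|apply: cvgMl_tmp; exact: cvg_id].
Qed.

(* Adding 1 to the cosine makes the integrand nonnegative, so that the
   fundamental theorem of calculus on a half-line applies.  The value b = 0
   gives the Poisson kernel, b = 1 the derivative of smooth_sign. *)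
Lemma integral_laplace_1Dcos (b z : R) : 0 <= b ->
  (\int[mu]_(t in `[0%R, +oo[) (expR (- t) * (1 + b * t) * (1 + cos (t * z)))%:E
   = ((1 + b) + ((1 + z ^+ 2)^-1 + b * (1 - z ^+ 2) / (1 + z ^+ 2) ^+ 2))%:E)%E.
Proof.
move=> b0.
have w0 : 1 + z ^+ 2 != 0 by rewrite gt_eqF// ltr_pwDl// sqr_ge0.
pose w := 1 + z ^+ 2.
(* These coefficients solve the linear system making the integrand the derivative of [F]. As [F]
   vanishes at infinity, the integral is [- F 0], that is [(1 + b) - q]. *)
pose p := - b / w; pose q := - 1 / w - b * (1 - z ^+ 2) / w ^+ 2.
pose r := b * z / w; pose s := z / w + b * (2 * z) / w ^+ 2.
pose F := fun t : R => expR (- t) * ((- b * t + - (1 + b)) + (p * t + q) * cos (t * z)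
       + (r * t + s) * sin (t * z)).
have dF (t : R) : is_derive t 1 F (expR (- t) * (1 + b * t) * (1 + cos (t * z))).
  have := laplace_is_derive (- b) (- (1 + b)) p q r s z t.
  move=> /is_derive_eq; apply.
  by rewrite /p /q /r /s /w; field.
rewrite (@ge0_continuous_FTC2y _ _ F 0 0).
- congr _%:E; rewrite /F oppr0 expR0 !mul0r cos0 sin0 /p /q /r /s /w.
  by field.
- move=> t t0; have c0 : 0 <= 1 + cos (t * z) by have := cos_geN1 (t * z); lra.
  by rewrite mulr_ge0// mulr_ge0 ?expR_ge0// addr_ge0 ?mulr_ge0.
- apply: continuous_subspaceT => t.
  apply: cvgM; first exact: continuous_expRN_poly.
  by apply: cvgD; [exact: cvg_cst|exact: continuous_cos_mulr].
- exact: laplace_cvg0.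
- by move=> t t0; have [] := dF t.
- apply: cvg_at_right_filter.
  by apply: differentiable_continuous; apply/derivable1_diffP; have [] := dF 0.
- by move=> t _; rewrite derive1E; exact: derive_val.
Qed.

Lemma measurable_fun_expRN_poly (b : R) D :
  measurable_fun D (fun t : R => expR (- t) * (1 + b * t)).
Proof.
apply: measurable_funTS; apply: continuous_measurable_fun.
exact: continuous_expRN_poly.
Qed.

Lemma measurable_fun_cos_mulr (z : R) D : measurable_fun D (fun t : R => cos (t * z)).
Proof.
by apply: measurable_funTS; apply: continuous_measurable_fun; exact: continuous_cos_mulr.
Qed.

(** At z = 0 the integrand of [integral_laplace_1Dcos] is twice this kernel, and its integral is
    finite. *)
Lemma integrable_expRN_poly (b : R) : 0 <= b ->
  mu.-integrable `]0, +oo[ (EFin \o (fun t : R => expR (- t) * (1 + b * t))).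
Proof.
move=> b0; apply: (@integrableS _ _ _ mu `[0, +oo[) => //.
  by apply: subset_itvr; rewrite bnd_simp.
have k0 (t : R) : 0 <= t -> 0 <= expR (- t) * (1 + b * t).
  by move=> t0; rewrite mulr_ge0 ?expR_ge0 ?addr_ge0 ?mulr_ge0.
have : mu.-integrable `[0, +oo[
    (EFin \o (fun t : R => expR (- t) * (1 + b * t) * (1 + cos (t * 0)))).
  apply: ge0_integrable_EFin (integral_laplace_1Dcos 0 b0) => //.
    apply: measurable_funM; first exact: measurable_fun_expRN_poly.
    by apply: measurable_funD => //; exact: measurable_fun_cos_mulr.
  move=> t /=; rewrite in_itv/= andbT => t0.
  by rewrite mulr0 cos0 mulr_ge0 ?k0.
apply: integrable_dominated => //; first exact: measurable_fun_expRN_poly.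
move=> t /=; rewrite in_itv/= andbT => t0.
by rewrite mulr0 cos0 ger0_norm ?k0// ler_peMr ?k0// lerDl.
Qed.

Lemma integrable_laplace_cos (b z : R) : 0 <= b ->
  mu.-integrable `]0, +oo[ (EFin \o (fun t : R => expR (- t) * (1 + b * t) * cos (t * z))).
Proof.
move=> b0; apply: integrable_dominated (integrable_expRN_poly b0) => //.
  by apply: measurable_funM; [exact: measurable_fun_expRN_poly|exact: measurable_fun_cos_mulr].
move=> t /=; rewrite in_itv/= andbT => /ltW t0.
rewrite normrM ger0_norm ?mulr_ge0 ?expR_ge0 ?addr_ge0 ?mulr_ge0//.
by rewrite ler_piMr ?cos_max// mulr_ge0 ?expR_ge0 ?addr_ge0 ?mulr_ge0.
Qed.

(** The half-line is opened at 0 here because later kernels carry a factor [1 / t]. *)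
Lemma Rintegral_laplace_1Dcos (b z : R) : 0 <= b ->
  \int[mu]_(t in `]0, +oo[) (expR (- t) * (1 + b * t)) +
  \int[mu]_(t in `]0, +oo[) (expR (- t) * (1 + b * t) * cos (t * z))
   = (1 + b) + ((1 + z ^+ 2)^-1 + b * (1 - z ^+ 2) / (1 + z ^+ 2) ^+ 2).
Proof.
move=> b0.
rewrite -RintegralD//; [|exact: integrable_expRN_poly|exact: integrable_laplace_cos].
rewrite -[RHS]/(fine _%:E) -integral_laplace_1Dcos// /Rintegral.
rewrite integral_itv_obnd_cbnd; last first.
  apply/measurable_EFinP; apply: measurable_funD; first exact: measurable_fun_expRN_poly.
  by apply: measurable_funM; [exact: measurable_fun_expRN_poly|exact: measurable_fun_cos_mulr].
by congr fine; apply: eq_integral => t _; rewrite [in RHS]mulrDr mulr1.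
Qed.

Lemma Rintegral_expRN_poly (b : R) : 0 <= b ->
  \int[mu]_(t in `]0, +oo[) (expR (- t) * (1 + b * t)) = 1 + b.
Proof.
(* At z = 0 the two integrals coincide and the identity says that twice the integral is
   [2 * (1 + b)]. *)
move=> b0; have := Rintegral_laplace_1Dcos 0 b0.
under [X in _ + X]eq_Rintegral do rewrite mulr0 cos0 mulr1.
by rewrite expr0n/= addr0 subr0 expr1n invr1 !mulr1; lra.
Qed.

Lemma Rintegral_laplace_cos (b z : R) : 0 <= b ->
  \int[mu]_(t in `]0, +oo[) (expR (- t) * (1 + b * t) * cos (t * z))
   = (1 + z ^+ 2)^-1 + b * (1 - z ^+ 2) / (1 + z ^+ 2) ^+ 2.
Proof.
move=> b0; have := Rintegral_laplace_1Dcos z b0.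
by rewrite Rintegral_expRN_poly// => /addrI.
Qed.

(** Through this identity, the integrability and the total mass 1 of the exponential density yield
    the integral of [expR (- (c * t))]. *)
Lemma restrict_exponential_pdf (c : R) :
  exponential_pdf c = (fun t => c * expR (- (c * t))) \_ `[0, +oo[.
Proof.
by apply/funext => t; rewrite /exponential_pdf !patchE; case: ifP; rewrite // mulNr.
Qed.

Lemma integrable_expRN (c : R) : 0 < c ->
  mu.-integrable `]0, +oo[ (EFin \o (fun t : R => expR (- (c * t)))).
Proof.
move=> c0; apply: (@integrableS _ _ _ mu `[0, +oo[) => //.
  by apply: subset_itvr; rewrite bnd_simp.
have := integrable_exponential_pdf c0.
rewrite restrict_exponential_pdf -restrict_EFin => /integrable_restrict.
rewrite setTI => H.
apply: (@eq_integrable _ _ _ mu `[0, +oo[ _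
  (fun t : R => (c^-1)%:E * (c * expR (- (c * t)))%:E)%E) => //; last first.
  by apply: integrableZl => //; apply: H.
move=> t _.
by rewrite /= -EFinM mulKf// gt_eqF.
Qed.

Lemma Rintegral_expRN (c : R) : 0 < c ->
  \int[mu]_(t in `]0, +oo[) expR (- (c * t)) = c^-1.
Proof.
move=> c0; have ic := integrable_expRN c0.
apply: (@mulfI _ c); first by rewrite gt_eqF.
rewrite divff ?gt_eqF// -RintegralZl//.
transitivity (\int[mu]_(t in `[0, +oo[) (c * expR (- (c * t)))).
  rewrite /Rintegral integral_itv_obnd_cbnd//.
  apply/measurable_EFinP; apply: measurable_funM => //.
  by apply/measurable_EFinP; case/integrableP: ic.
rewrite Rintegral_mkcond -restrict_exponential_pdf /Rintegral.
by rewrite integral_exponential_pdf.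
Qed.

End laplace_transform.

(** * The smoothed sign and its distance to the sign function *)

Lemma lipschitz_sin (R : realType) (x y : R) : `|sin x - sin y| <= `|x - y|.
Proof.
wlog xy : x y / y < x => [h|].
  have [yx|xy|->] := ltgtP y x; last by rewrite !subrr.
    exact: h.
  by rewrite distrC [leRHS]distrC; exact: h.
have ds (z : R) : z \in `]y, x[ -> is_derive z 1 (@sin R) (cos z).
  by move=> _; exact: is_derive_sin.
have cs : {within `[y, x], continuous (@sin R)}.
  by apply: continuous_subspaceT => z; exact: continuous_sin.
have [c _ ->] := MVT xy ds cs.
by rewrite normrM ler_piMl// cos_max.
Qed.

(** This is twice the primitive of (1 + z^2)^-2 that vanishes at 0: an odd increasing function with
    limits -pi/2 and pi/2. *)
Definition smooth_sign (R : realType) (z : R) : R := atan z + z / (1 + z ^+ 2).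

Lemma smooth_signN (R : realType) (z : R) : smooth_sign (- z) = - smooth_sign z.
Proof. by rewrite /smooth_sign atanN sqrrN mulNr opprD. Qed.

Lemma atan_gt0 (R : realType) (x : R) : 0 < x -> 0 < atan x.
Proof. by move=> x0; rewrite -[ltLHS](@atan0 R) lt_atan. Qed.

(** By the mean value theorem, atan u = u / (1 + c^2) for some c between 0 and u. *)
Lemma atan_bounds (R : realType) (u : R) : 0 < u -> u / (1 + u ^+ 2) <= atan u <= u.
Proof.
move=> u0.
have da (z : R) : z \in `]0, u[ -> is_derive z 1 (@atan R) (1 + z ^+ 2)^-1.
  by move=> _; exact: is_derive1_atan.
have ca : {within `[0, u], continuous (@atan R)}.
  by apply: continuous_subspaceT => z; exact: continuous_atan.
have [c + ] := MVT u0 da ca.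
rewrite in_itv/= atan0 !subr0 => /andP[c0 cu] ->.
have c1 : 1 <= 1 + c ^+ 2 by rewrite lerDl sqr_ge0.
apply/andP; split; last by rewrite ler_piMl ?(ltW u0)// invf_le1// (lt_le_trans _ c1).
rewrite mulrC ler_wpM2r ?(ltW u0)// lef_pV2 ?posrE ?ltr_pwDl ?sqr_ge0//.
by rewrite lerD2l !expr2 ler_pM// ltW.
Qed.

Lemma atanV (R : realType) (z : R) : 0 < z -> atan z^-1 = pi / 2 - atan z.
Proof.
move=> z0; rewrite -[RHS]tanK; last first.
  rewrite in_itv/=; have := atan_ltpi2 z; have := atan_gt0 z0; have := @pi_gt0 R.
  by lra.
congr atan; rewrite /tan sinB cosB sin_pihalf cos_pihalf !mul0r mul1r subr0 add0r mul1r.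
by rewrite -[in LHS](atanK z) /tan invf_div.
Qed.

(* For z > 1 the difference is atan u - u / (1 + u^2) with u = 1/z. *)
Lemma smooth_sign_pos (R : realType) (z : R) : 0 <= z ->
  `|pi / 2 - smooth_sign z| <= 4 * (1 + z ^+ 2)^-1.
Proof.
move=> z0; have w0 : 0 < 1 + z ^+ 2 by rewrite ltr_pwDl// sqr_ge0.
have [z1|z1] := leP z 1.
  (* For z <= 1 crude bounds suffice: the right side is at least 2, and the difference lies between
     -1 and pi/2 < 2. *)
  have z4 : 2 <= 4 * (1 + z ^+ 2)^-1 by rewrite ler_pdivlMr//; nra.
  have a0 : 0 <= atan z by rewrite -[leLHS](@atan0 R) le_atan.
  have := atan_ltpi2 z; have := @pihalf_lt2 R; rewrite /smooth_sign.
  have : 0 <= z / (1 + z ^+ 2) by rewrite divr_ge0// ltW.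
  have : z / (1 + z ^+ 2) <= 1 by rewrite ler_pdivrMr//; nra.
  by move: (z / _) => v *; rewrite ler_norml; apply/andP; split; lra.
have zp : 0 < z by lra.
rewrite /smooth_sign opprD addrA -atanV//.
have u0 : 0 < z^-1 by rewrite invr_gt0.
have /andP[] := atan_bounds u0.
(* Since u / (1 + u^2) is invariant under inversion, [atan_bounds] puts the difference between 0 and
   1/z - z / (1 + z^2), which equals (1/z) / (1 + z^2). *)
have -> : z^-1 / (1 + z^-1 ^+ 2) = z / (1 + z ^+ 2).
  by field; rewrite gt_eqF//= gt_eqF//= addrC.
have : z^-1 = z / (1 + z ^+ 2) + z^-1 * (1 + z ^+ 2)^-1 by field; rewrite !gt_eqF.
have : z^-1 * (1 + z ^+ 2)^-1 <= (1 + z ^+ 2)^-1.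
  by rewrite ler_piMl ?invr_ge0 ?(ltW w0)// invf_le1// ltW.
have : 0 < (1 + z ^+ 2)^-1 by rewrite invr_gt0.
by move=> *; rewrite ler_norml; apply/andP; split; lra.
Qed.

Lemma smooth_sign_neg (R : realType) (z : R) : z <= 0 ->
  `|- (pi / 2) - smooth_sign z| <= 4 * (1 + z ^+ 2)^-1.
Proof.
move=> z0; have := @smooth_sign_pos _ (- z).
by rewrite oppr_ge0 => /(_ z0); rewrite smooth_signN sqrrN opprK -opprD normrN.
Qed.

(** * Sine-integral representation of the smoothed sign *)

Section smooth_sign_transform.
Context {R : realType}.
Local Notation mu := (@lebesgue_measure R).

Lemma measurable_fun_sin_mulrV (z : R) :
  measurable_fun (`]0%R, +oo[ : set R) (fun t : R => sin (t * z) / t).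
Proof.
apply: open_continuous_measurable_fun => //.
move=> t; rewrite inE/= in_itv/= andbT => t0.
apply: cvgM; first exact: continuous_sin_mulr.
by apply: cvgV; [rewrite gt_eqF|exact: cvg_id].
Qed.

Lemma measurable_fun_kernel_sin (z : R) : 
  measurable_fun (`]0%R, +oo[ : set R) (fun t : R => expR (- t) * (1 + 1 * t) * (sin (t * z) / t)).
Proof.
by apply: measurable_funM; [exact: measurable_fun_expRN_poly|exact: measurable_fun_sin_mulrV].
Qed.

(** The inequality |sin (t z)| <= t |z| removes the singularity at t = 0. *)
Lemma integrable_kernel_sin (z : R) : 
  mu.-integrable `]0, +oo[ (EFin \o (fun t : R => expR (- t) * (1 + 1 * t) * (sin (t * z) / t))).
Proof.
have h : mu.-integrable `]0, +oo[ (EFin \o (fun t : R => `|z| * (expR (- t) * (1 + 1 * t)))).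
  by apply: integrableZl_EFin => //; apply: integrable_expRN_poly.
apply: integrable_dominated h => //.
  exact: measurable_fun_kernel_sin.
move=> t /=; rewrite in_itv/= andbT => t0.
have k0 : 0 <= expR (- t) * (1 + 1 * t).
  by rewrite mul1r mulr_ge0 ?expR_ge0// addr_ge0// ltW.
rewrite normrM (ger0_norm k0) mulrC ler_wpM2r//.
rewrite normf_div (gtr0_norm t0) ler_pdivrMr//.
have := lipschitz_sin (t * z) 0.
by rewrite sin0 !subr0 normrM (gtr0_norm t0) [`|z| * t]mulrC.
Qed.

Lemma is_derive_kernel_sin (z t : R) : 0 < t ->
  is_derive z 1 (fun z : R => expR (- t) * (1 + 1 * t) * (sin (t * z) / t))
    (expR (- t) * (1 + 1 * t) * cos (t * z)).
Proof.
move=> t0.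
have dz : is_derive z 1 (fun z : R => t * z) t.
  have := is_derive1_mulr (is_derive_cst t z 1) (is_derive_id z 1).
  by rewrite mulr0 mulr1 addr0.
have ds := @is_derive1_comp _ sin (fun z : R => t * z) _ _ _ (is_derive_sin (t * z)) dz.
have dt := is_derive1_mulr ds (is_derive_cst t^-1 z 1).
have := is_derive1_mulr (is_derive_cst (expR (- t) * (1 + 1 * t)) z 1) dt.
move=> /is_derive_eq; apply => /=.
by field; rewrite gt_eqF.
Qed.

(** Differentiation under the integral sign: the derivative in z cancels the factor [1 / t] and
    leaves the cosine transform with b = 1, dominated by the kernel uniformly in z. *)
Lemma is_derive_Rintegral_kernel_sin (z : R) :
  is_derive z 1 (fun z => \int[mu]_(t in `]0, +oo[) (expR (- t) * (1 + 1 * t) * (sin (t * z) / t)))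
    ((1 + z ^+ 2)^-1 + 1 * (1 - z ^+ 2) / (1 + z ^+ 2) ^+ 2).
Proof.
pose f z t := expR (- t) * (1 + 1 * t) * (sin (t * z) / t) : R.
have Iz : `](z - 1), (z + 1)[%classic z by rewrite /= in_itv/=; lra.
have df x y : `](z - 1), (z + 1)[%classic x -> `]0, +oo[%classic y -> derivable (f ^~ y) x 1.
  by move=> _ /=; rewrite in_itv/= andbT => y0; have [] := is_derive_kernel_sin x y0.
have d1 x y : 0 < y -> partial1of2 f x y = expR (- y) * (1 + 1 * y) * cos (y * x).
  move=> y0; rewrite /partial1of2 derive1E.
  by have h := is_derive_kernel_sin x y0; exact: derive_val.
pose G (y : R) := `|expR (- y) * (1 + 1 * y)| : R.
have intG : mu.-integrable `]0, +oo[ (EFin \o G).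
  have h := @integrable_expRN_poly R 1 ler01.
  exact: integrable_norm h.
have Gub x y : `](z - 1), (z + 1)[%classic x -> `]0, +oo[%classic y ->
    `|partial1of2 f x y| <= G y.
  move=> _ y0; rewrite d1 ?normrM; last by move: y0; rewrite /= in_itv/= andbT.
  by rewrite /G normrM ler_piMr ?mulr_ge0// cos_max.
have intf x : `](z - 1), (z + 1)[%classic x -> mu.-integrable `]0, +oo[ (EFin \o f x).
  by move=> _; exact: integrable_kernel_sin.
have mD : measurable (`]0, +oo[%classic : set (measurableTypeR R)) by [].
apply: DeriveDef.
  exact: (derivable_under_integral mD Iz intf df (fun y => normr_ge0 _) intG Gub).
rewrite -derive1E (differentiation_under_integral mD Iz intf df (fun y => normr_ge0 _) intG Gub).
rewrite -Rintegral_laplace_cos//; apply: eq_Rintegral => y.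
by rewrite inE/= in_itv/= andbT; exact: d1.
Qed.

(** The derivative is left unsimplified so that it is literally the one in
    [is_derive_Rintegral_kernel_sin]. *)
Lemma is_derive_smooth_sign (z : R) :
  is_derive z 1 (@smooth_sign R) ((1 + z ^+ 2)^-1 + 1 * (1 - z ^+ 2) / (1 + z ^+ 2) ^+ 2).
Proof.
have w0 : 1 + z ^+ 2 != 0 by rewrite gt_eqF// ltr_pwDl// sqr_ge0.
have d2 := is_deriveD (@is_derive_cst R R R 1 z 1)
  (is_derive1_mulr (is_derive_id z 1) (is_derive_id z 1)).
have dV := @is_deriveV _ (fun z : R => 1 + z ^+ 2) z _ 1 w0 d2.
have := is_deriveD (is_derive1_atan z) (is_derive1_mulr (is_derive_id z 1) dV).
move=> /is_derive_eq; apply => /=.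
by rewrite /GRing.scale/=; field.
Qed.

(** Both sides have the same derivative and vanish at 0. *)
Lemma Rintegral_kernel_sin (z : R) :
  \int[mu]_(t in `]0, +oo[) (expR (- t) * (1 + 1 * t) * (sin (t * z) / t)) = smooth_sign z.
Proof.
pose F z := \int[mu]_(t in `]0, +oo[) (expR (- t) * (1 + 1 * t) * (sin (t * z) / t)).
have d0 (x : R) : is_derive x 1 (fun x => F x - smooth_sign x) 0.
  have := is_deriveB (is_derive_Rintegral_kernel_sin x) (is_derive_smooth_sign x).
  by rewrite subrr.
have := is_derive_0_is_cst (f := fun x => F x - smooth_sign x) z 0 d0.
rewrite /smooth_sign atan0 mul0r addr0 subr0 -/(smooth_sign z).
have -> : F 0 = 0.
  rewrite /F (@eq_Rintegral _ _ _ _ _ (cst 0)) ?Rintegral_cst ?mul0r//.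
  by move=> t _; rewrite mulr0 sin0 mul0r mulr0.
by move/eqP; rewrite subr_eq0 => /eqP.
Qed.

End smooth_sign_transform.

(** * Exchange of an expectation with a kernel integral *)

Lemma bounded_integrable_EFin d (T : measurableType d) (R : realType)
    (P : probability T R) (f : T -> R) (M : R) :
  measurable_fun setT f -> (forall w, `|f w| <= M) ->
  P.-integrable setT (EFin \o f).
Proof.
move=> mf fM; apply: (@integrable_dominated _ _ _ _ _ _ (cst M)) => //.
exact: finite_measure_integrable_cst.
Qed.

Section Fubini_kernel.
Context d (T : measurableType d) (R : realType) (P : probability T R).
Local Notation mu := (@lebesgue_measure R).
Variables (h k : R -> R) (c : T -> R -> R) (M : R).
Hypothesis mh : measurable_fun (`]0%R, +oo[ : set R) h.
Hypothesis mc : measurable_fun setT (fun z : T * R => c z.1 z.2).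
Hypothesis cM : forall w t, `|c w t| <= M.
Hypothesis hck : forall w t, 0 < t -> `|h t * c w t| <= k t.
Hypothesis ik : mu.-integrable `]0, +oo[ (EFin \o k).

(** Extending the kernel by zero outside the open half-line allows Fubini to be applied with the
    full Lebesgue measure. *)
Let f (z : T * R) : \bar R := ((h \_ `]0, +oo[) z.2 * c z.1 z.2)%:E.

Let mf : measurable_fun setT f.
Proof.
apply/measurable_EFinP; apply: measurable_funM => //.
apply: (@measurableT_comp _ _ _ _ _ _ (h \_ `]0, +oo[)) => //.
by apply/(measurable_restrictT _ _).1 => //.
Qed.

Let mcw w : measurable_fun setT (c w).
Proof. by have := measurableT_comp mc (@measurable_pair1 _ _ T R w). Qed.

Let mct t : measurable_fun setT (c ^~ t).
Proof. by have := measurableT_comp mc (@measurable_pair2 _ _ T R t). Qed.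

Let integral_f w : (\int[mu]_t f (w, t) = \int[mu]_(t in `]0%R, +oo[) (h t * c w t)%:E)%E.
Proof.
rewrite [RHS]integral_mkcond; apply: eq_integral => t _.
by rewrite /f/= !patchE; case: ifP; rewrite // mul0r.
Qed.

Let integral_absf w :
  (\int[mu]_t `|f (w, t)| = \int[mu]_(t in `]0%R, +oo[) `|h t * c w t|%:E)%E.
Proof.
rewrite [RHS]integral_mkcond; apply: eq_integral => t _.
by rewrite /f/= !patchE; case: ifP; rewrite // mul0r normr0.
Qed.

Let intw w : mu.-integrable `]0, +oo[ (EFin \o (fun t => h t * c w t)).
Proof.
apply: integrable_dominated ik => //.
  by apply: measurable_funM; [exact: mh|exact: (measurable_funTS (mcw w))].
by move=> t /=; rewrite in_itv/= andbT; exact: hck.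
Qed.

Let intt t : P.-integrable setT (EFin \o (c ^~ t)).
Proof. exact: bounded_integrable_EFin. Qed.

(** By Tonelli: the inner integral of |f| is at most the integral of |k|, a finite constant, and [P]
    has mass 1. *)
Let intf : (P \x mu)%E.-integrable setT f.
Proof.
apply/integrable12ltyP => //.
apply: (@le_lt_trans _ _ (\int[P]_w (\int[mu]_(t in `]0%R, +oo[) `|(k t)%:E|))%E).
  apply: ge0_le_integral => //.
  - by move=> w _; exact: integral_ge0.
  - apply: (@measurable_fun_fubini_tonelli_F _ _ _ _ _ mu (abse \o f)).
      exact: measurableT_comp.
    by move=> z /=.
  move=> w _; rewrite integral_absf; apply: ge0_le_integral => //.
  - apply/measurable_EFinP. apply: measurableT_comp => //.
    by have /integrableP[/measurable_EFinP] := intw w.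
  - by apply: measurableT_comp => //; have /integrableP[] := ik.
  move=> t; rewrite /= in_itv/= andbT => t0; rewrite lee_fin (le_trans (hck w t0))//.
  exact: ler_norm.
have /integrableP[_] := ik; rewrite /=.
move: (\int[mu]_(t in `]0%R, +oo[) `|(k t)%:E|)%E => I Ioo.
have -> : (\int[P]_w I = I)%E.
  by rewrite (integral_cst P measurableT) -[RHS]mule1 -(probability_setT P).
by [].
Qed.

Let integral_ft t : (\int[P]_w f (w, t) = ((h \_ `]0, +oo[) t * \int[P]_w c w t)%:E)%E.
Proof.
rewrite /f/=; under eq_integral do rewrite EFinM.
rewrite integralZl//; last exact: intt.
by rewrite /Rintegral -[X in (_ * X)%E]fineK//; exact: integrable_fin_num (intt t).
Qed.

Lemma integrable_kernel_expectation :
  mu.-integrable `]0, +oo[ (EFin \o (fun t => h t * \int[P]_w c w t)).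
Proof.
(* Measurability in t of the expectation is read off the marginal [fubini_G] of the integrable
   function [f]. *)
have mG : measurable_fun setT (fun t => (h \_ `]0, +oo[) t * \int[P]_w c w t).
  apply/measurable_EFinP; apply: eq_measurable_fun (measurable_fubini_G intf).
  by move=> t _; rewrite /fubini_G integral_ft.
apply: (integrable_dominated _ _ _ ik) => //.
  apply: eq_measurable_fun (measurable_funTS mG).
  by move=> t t0; rewrite patchE t0.
move=> t; rewrite /= in_itv/= andbT => t0.
have ic : P.-integrable setT (EFin \o (fun w => `|c w t|)) by exact: integrable_norm (intt t).
rewrite normrM (@le_trans _ _ (\int[P]_w (`|h t| * `|c w t|)))//.
  by rewrite RintegralZl// ler_wpM2l// le_normr_Rintegral//; exact: intt.
apply: (@le_trans _ _ (\int[P]_w (cst (k t) w))).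
  apply: le_Rintegral => //.
  - exact: (integrableZl_EFin _ _ ic).
  - exact: finite_measure_integrable_cst.
  by move=> w _; rewrite -normrM; exact: hck.
by rewrite Rintegral_cst// [X in _ * fine X](@probability_setT _ _ _ P) mulr1.
Qed.

Lemma Rintegral_kernel_swap :
  \int[P]_w (\int[mu]_(t in `]0, +oo[) (h t * c w t)) =
  \int[mu]_(t in `]0, +oo[) (h t * \int[P]_w c w t).
Proof.
rewrite /Rintegral; congr fine.
transitivity (\int[P]_w \int[mu]_t f (w, t))%E.
  apply: eq_integral => w _; rewrite integral_f fineK//.
  exact: integrable_fin_num (intw w).
rewrite Fubini// [RHS]integral_mkcond; apply: eq_integral => t _.
by rewrite integral_ft !patchE; case: ifP; rewrite // mul0r.
Qed.

End Fubini_kernel.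

(** * Smoothed expectations as integrals of a real characteristic function *)

Section characteristic_function_smoothing.
Context d (T : measurableType d) (R : realType) (P : probability T R).
Local Notation mu := (@lebesgue_measure R).
Variables (Y : {RV P >-> R}) (phi : R -> R).
Hypothesis Ecos : forall t, \int[P]_w cos (t * Y w) = phi t.
Hypothesis Esin : forall t, \int[P]_w sin (t * Y w) = 0.

Let mY : measurable_fun setT (Y : T -> R).
Proof. exact: measurable_funPT. Qed.

Let msin : measurable_fun setT (@sin R).
Proof. by apply: continuous_measurable_fun; exact: continuous_sin. Qed.

Let mcos : measurable_fun setT (@cos R).
Proof. by apply: continuous_measurable_fun; exact: continuous_cos. Qed.

Let integrable_cosY t : P.-integrable setT (EFin \o (fun w => cos (t * Y w))).
Proof.
apply: (@bounded_integrable_EFin _ _ _ _ _ 1); last by move=> w; exact: cos_max.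
by apply: (measurableT_comp mcos); exact: measurable_funM.
Qed.

Let integrable_sinY t : P.-integrable setT (EFin \o (fun w => sin (t * Y w))).
Proof.
apply: (@bounded_integrable_EFin _ _ _ _ _ 1); last by move=> w; exact: sin_max.
by apply: (measurableT_comp msin); exact: measurable_funM.
Qed.

(** After the subtraction formula only the cosine expectation survives, the characteristic function
    being real. *)
Lemma expectation_sin_affine (t x e : R) :
  \int[P]_w sin (t * ((Y w - x) / e)) = - (phi (t / e) * sin (t * (x / e))).
Proof.
rewrite (@eq_Rintegral _ _ _ _ _ (fun w => cos (t * (x / e)) * sin (t / e * Y w)
    - sin (t * (x / e)) * cos (t / e * Y w))); last first.
  move=> w _; rewrite (_ : t * _ = t / e * Y w - t * (x / e)); last by ring.
  by rewrite sinB mulrC [X in _ - X]mulrC.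
rewrite RintegralB//; [|exact: integrableZl_EFin|exact: integrableZl_EFin].
by rewrite !RintegralZl// Ecos Esin mulr0 sub0r mulrC.
Qed.

Lemma expectation_cos_affine (t x e : R) :
  \int[P]_w cos (t * ((Y w - x) / e)) = phi (t / e) * cos (t * (x / e)).
Proof.
rewrite (@eq_Rintegral _ _ _ _ _ (fun w => cos (t * (x / e)) * cos (t / e * Y w)
    + sin (t * (x / e)) * sin (t / e * Y w))); last first.
  move=> w _; rewrite (_ : t * _ = t / e * Y w - t * (x / e)); last by ring.
  by rewrite cosB mulrC [X in _ + X]mulrC.
rewrite RintegralD//; [|exact: integrableZl_EFin|exact: integrableZl_EFin].
by rewrite !RintegralZl// Ecos Esin mulr0 addr0 mulrC.
Qed.

Let maffine x e : measurable_fun setT (fun z : T * R => z.2 * ((Y z.1 - x) / e)).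
Proof.
apply: measurable_funM => //; apply: measurable_funM => //.
by apply: measurable_funB => //; exact: (measurableT_comp mY).
Qed.

(** The Poisson kernel is the case b = 0 of [Rintegral_laplace_cos]; the factor [1 + 0 * t] keeps
    the shape shared with the case b = 1. *)
Lemma expectation_cauchy (x e : R) :
  \int[P]_w (1 + ((Y w - x) / e) ^+ 2)^-1 =
    \int[mu]_(t in `]0, +oo[) (expR (- t) * (1 + 0 * t) * (phi (t / e) * cos (t * (x / e)))).
Proof.
under [RHS]eq_Rintegral do rewrite -expectation_cos_affine.
rewrite -(@Rintegral_kernel_swap _ _ _ _ _ (fun t => expR (- t) * (1 + 0 * t)) _ 1).
- apply: eq_Rintegral => w _.
  by rewrite Rintegral_laplace_cos// !mul0r addr0.
- exact: measurable_fun_expRN_poly.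
- exact: (measurableT_comp mcos (maffine x e)).
- by move=> w t; exact: cos_max.
- move=> w t t0; have k0 : 0 <= expR (- t) * (1 + 0 * t) by rewrite mul0r addr0 mulr1 expR_ge0.
  by rewrite normrM (ger0_norm k0) ler_piMr// cos_max.
- exact: integrable_expRN_poly.
Qed.

Lemma integrable_cauchy (x e : R) :
  mu.-integrable `]0, +oo[ (EFin \o (fun t : R => 
     expR (- t) * (1 + 0 * t) * (phi (t / e) * cos (t * (x / e))))).
Proof.
rewrite (_ : (fun _ => _) = (fun t : R => expR (- t) * (1 + 0 * t) *
    \int[P]_w cos (t * ((Y w - x) / e)))); last first.
  by apply/funext => t; rewrite expectation_cos_affine.
apply: (@integrable_kernel_expectation _ _ _ _ _ (fun t => expR (- t) * (1 + 0 * t)) _ 1).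
- exact: measurable_fun_expRN_poly.
- exact: (measurableT_comp mcos (maffine x e)).
- by move=> w t; exact: cos_max.
- move=> w t t0; have k0 : 0 <= expR (- t) * (1 + 0 * t) by rewrite mul0r addr0 mulr1 expR_ge0.
  by rewrite normrM (ger0_norm k0) ler_piMr// cos_max.
- exact: integrable_expRN_poly.
Qed.

Let h (t : R) := expR (- t) * (1 + 1 * t) / t.
Let c a b e w t := sin (t * ((Y w - a) / e)) - sin (t * ((Y w - b) / e)).

Let mh : measurable_fun (`]0%R, +oo[ : set R) h.
Proof.
apply: measurable_funM; first exact: measurable_fun_expRN_poly.
apply: open_continuous_measurable_fun => //.
move=> t; rewrite inE/= in_itv/= andbT => t0.
by apply: cvgV; [rewrite gt_eqF|exact: cvg_id].
Qed.

Let mc a b e : measurable_fun setT (fun z : T * R => c a b e z.1 z.2).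
Proof.
by apply: measurable_funB; exact: (measurableT_comp msin (maffine _ _)).
Qed.

Let cM a b e w t : `|c a b e w t| <= 2.
Proof. by rewrite (le_trans (ler_normB _ _))// lerD ?sin_max. Qed.

(** The Lipschitz bound on the difference of sines is t |b - a| / |e| whatever [Y w] is, which
    absorbs the singularity of [h]. This is the reason for working with increments: for a single
    sine the same argument gives a bound growing with |Y w|. *)
Let hck a b e w t : 0 < t ->
  `|h t * c a b e w t| <= `|(b - a) / e| * (expR (- t) * (1 + 1 * t)).
Proof.
move=> t0; have k0 : 0 <= expR (- t) * (1 + 1 * t).
  by rewrite mul1r mulr_ge0 ?expR_ge0// addr_ge0// ltW.
rewrite /h normrM normrM (ger0_norm k0) -mulrA mulrC ler_wpM2r//.
rewrite normfV (gtr0_norm t0) ler_pdivrMl//.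
rewrite (le_trans (lipschitz_sin _ _))// -mulrBr normrM (gtr0_norm t0) ler_wpM2l ?(ltW t0)//.
by rewrite -mulrBl opprB [Y w - a + _]addrC addrA subrK.
Qed.

Let Ec a b e t :
  \int[P]_w c a b e w t = phi (t / e) * (sin (t * (b / e)) - sin (t * (a / e))).
Proof.
rewrite /c RintegralB//.
- by rewrite !expectation_sin_affine; ring.
- apply: (@bounded_integrable_EFin _ _ _ _ _ 1); last by move=> w; exact: sin_max.
  apply: (measurableT_comp msin); apply: measurable_funM => //.
  by apply: measurable_funM => //; exact: measurable_funB.
- apply: (@bounded_integrable_EFin _ _ _ _ _ 1); last by move=> w; exact: sin_max.
  apply: (measurableT_comp msin); apply: measurable_funM => //.
  by apply: measurable_funM => //; exact: measurable_funB.
Qed.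

Lemma expectation_smooth_sign (a b e : R) :
  \int[P]_w (smooth_sign ((Y w - a) / e) - smooth_sign ((Y w - b) / e)) =
    \int[mu]_(t in `]0, +oo[) (expR (- t) * (1 + 1 * t) / t *
       (phi (t / e) * (sin (t * (b / e)) - sin (t * (a / e))))).
Proof.
under [RHS]eq_Rintegral do rewrite -Ec.
rewrite -(@Rintegral_kernel_swap _ _ _ P _ _ _ _ mh (mc a b e) (cM a b e) (hck a b e)); last first.
  by apply: integrableZl_EFin => //; exact: integrable_expRN_poly.
apply: eq_Rintegral => w _; rewrite -!Rintegral_kernel_sin -RintegralB//.
- by apply: eq_Rintegral => t _; rewrite /h /c; ring.
- exact: integrable_kernel_sin.
- exact: integrable_kernel_sin.
Qed.

Lemma integrable_smooth_sign (a b e : R) :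
  mu.-integrable `]0, +oo[ (EFin \o (fun t : R => expR (- t) * (1 + 1 * t) / t *
       (phi (t / e) * (sin (t * (b / e)) - sin (t * (a / e)))))).
Proof.
rewrite (_ : (fun _ => _) = (fun t : R => h t * \int[P]_w c a b e w t)); last first.
  by apply/funext => t; rewrite Ec.
apply: (@integrable_kernel_expectation _ _ _ P _ _ _ _ mh (mc a b e) (cM a b e) (hck a b e)).
by apply: integrableZl_EFin => //; exact: integrable_expRN_poly.
Qed.

End characteristic_function_smoothing.

(** * Comparison of distribution functions with smoothed expectations *)

Lemma smooth_sign_step (R : realType) (b e y : R) : 0 < e ->
  `|pi * (y <= b)%R%:R - pi / 2 + smooth_sign ((y - b) / e)|
    <= 4 * (1 + ((y - b) / e) ^+ 2)^-1.
Proof.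
move=> e0; have [yb|yb] := leP y b.
  have z0 : (y - b) / e <= 0 by rewrite pmulr_lle0 ?invr_gt0// subr_le0.
  rewrite (le_trans _ (smooth_sign_neg z0))// (_ : _%:R = 1)// mulr1 -normrN.
  by move: (smooth_sign _) => u; rewrite (_ : - (pi - pi / 2 + u) = - (pi / 2) - u)//; lra.
have z0 : 0 <= (y - b) / e by rewrite divr_ge0 ?subr_ge0// ltW.
rewrite (le_trans _ (smooth_sign_pos z0))// -normrN mulr0 sub0r.
by rewrite opprD opprK.
Qed.

Lemma expRN_1Dx_le1 (R : realType) (t : R) : expR (- t) * (1 + t) <= 1.
Proof. by rewrite expRN ler_pdivrMl ?expR_gt0// mulr1 expR_ge1Dx. Qed.

Section cdf_smoothing.
Context d (T : measurableType d) (R : realType) (P : probability T R).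
Local Notation mu := (@lebesgue_measure R).
Variables (Y : {RV P >-> R}).

Let mY : measurable_fun setT (Y : T -> R).
Proof. exact: measurable_funPT. Qed.

Let maffine x e : measurable_fun setT (fun w : T => (Y w - x) / e).
Proof. by apply: measurable_funM => //; exact: measurable_funB. Qed.

Let integrable_cauchyY x e :
  P.-integrable setT (EFin \o (fun w => (1 + ((Y w - x) / e) ^+ 2)^-1)).
Proof.
apply: (@bounded_integrable_EFin _ _ _ _ _ 1).
  apply: (@measurableT_comp _ _ _ _ _ _ (fun u : R => (1 + u ^+ 2)^-1)) => //.
  apply: continuous_measurable_fun => u.
  apply: cvgV; first by rewrite gt_eqF// ltr_pwDl// sqr_ge0.
  by apply: cvgD; [exact: cvg_cst|exact: exprn_continuous].
move=> w; rewrite ger0_norm ?invr_ge0 ?addr_ge0 ?sqr_ge0//.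
by rewrite invf_le1 ?lerDl ?sqr_ge0// ltr_pwDl// sqr_ge0.
Qed.

Lemma continuous_smooth_sign : continuous (@smooth_sign R).
Proof.
move=> z; apply: differentiable_continuous; apply/derivable1_diffP.
by have [] := is_derive_smooth_sign z.
Qed.

Lemma smooth_sign_bounded (z : R) : `|smooth_sign z| <= pi + 4.
Proof.
have w (u : R) : 4 * (1 + u ^+ 2)^-1 <= 4.
  by rewrite ler_piMr// invf_le1 ?lerDl ?sqr_ge0// ltr_pwDl// sqr_ge0.
have := @pi_gt0 R; have := w z.
have [/smooth_sign_pos|/ltW/smooth_sign_neg] := leP 0 z;
  by rewrite !ler_norml => /andP[? ?] *; apply/andP; split; lra.
Qed.

Let integrable_smooth_signY x e :
  P.-integrable setT (EFin \o (fun w => smooth_sign ((Y w - x) / e))).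
Proof.
apply: (@bounded_integrable_EFin _ _ _ _ _ (pi + 4)); last by move=> w; exact: smooth_sign_bounded.
apply: (@measurableT_comp _ _ _ _ _ _ (@smooth_sign R)) => //.
by apply: continuous_measurable_fun; exact: continuous_smooth_sign.
Qed.

Let stepE b : (fun w => (Y w <= b)%R%:R : R) = \1_(Y @^-1` `]-oo, b]).
Proof.
apply/funext => w; rewrite indicE; congr ((nat_of_bool _)%:R).
by apply/idP/idP; rewrite inE/= in_itv/=.
Qed.

Let measurable_step b : measurable (Y @^-1` `]-oo, b]).
Proof. by rewrite -[X in measurable X]setTI; exact: mY. Qed.

Let integrable_step b :
  P.-integrable setT (EFin \o (fun w => (Y w <= b)%R%:R : R)).
Proof.
apply: (@bounded_integrable_EFin _ _ _ _ _ 1); last first.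
  by move=> w; case: (Y w <= b); rewrite /= ?normr1 ?normr0.
by rewrite stepE; exact: measurable_indic.
Qed.

Lemma Rintegral_step b : \int[P]_w (Y w <= b)%R%:R = fine (cdf Y b).
Proof. by rewrite stepE /Rintegral integral_indic// setIT. Qed.

(** The left side is the difference of the expectations of the pointwise errors of
    [smooth_sign_step] at [b] and at [a], where the constants pi/2 cancel. *)
Lemma cdf_smooth_sign (a b e : R) : 0 < e ->
  `|pi * (fine (cdf Y b) - fine (cdf Y a)) -
    \int[P]_w (smooth_sign ((Y w - a) / e) - smooth_sign ((Y w - b) / e))| <=
  4 * \int[P]_w (1 + ((Y w - a) / e) ^+ 2)^-1
  + 4 * \int[P]_w (1 + ((Y w - b) / e) ^+ 2)^-1.
Proof.
move=> e0.
pose f x w := pi * (Y w <= x)%R%:R - pi / 2 + smooth_sign ((Y w - x) / e).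
have icst : P.-integrable setT (EFin \o (fun _ => pi / 2 : R)).
  exact: finite_measure_integrable_cst.
have iS x : P.-integrable setT (EFin \o (fun w => pi * (Y w <= x)%R%:R : R)).
  exact: integrableZl_EFin.
have iSB x : P.-integrable setT (EFin \o (fun w => pi * (Y w <= x)%R%:R - pi / 2 : R)).
  exact: integrableB_EFin.
have iF x : P.-integrable setT (EFin \o f x) by exact: integrableD_EFin.
have iC x : P.-integrable setT (EFin \o (fun w => 4 * (1 + ((Y w - x) / e) ^+ 2)^-1)).
  exact: integrableZl_EFin.
have bnd x : `|\int[P]_w f x w| <= 4 * \int[P]_w (1 + ((Y w - x) / e) ^+ 2)^-1.
  rewrite (le_trans (le_normr_Rintegral _ (iF x)))// -RintegralZl//.
  apply: le_Rintegral => //; first exact: integrable_norm (iF x).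
  by move=> w _; exact: smooth_sign_step.
have fE x : \int[P]_w f x w = pi * fine (cdf Y x) - \int[P]_w (cst (pi / 2) w)
    + \int[P]_w smooth_sign ((Y w - x) / e).
  by rewrite -Rintegral_step -RintegralZl// -RintegralB// -RintegralD.
rewrite RintegralB// (_ : _ - _ = \int[P]_w f b w - \int[P]_w f a w).
  by rewrite (le_trans (ler_normB _ _))// addrC lerD.
by rewrite !fE; ring.
Qed.

End cdf_smoothing.

(** * A smoothing inequality for increments of distribution functions *)

Section smoothing_inequality.
Context (R : realType).
Local Notation mu := (@lebesgue_measure R).
Variable e : R.
Hypothesis e0 : 0 < e.
(** With this rate the integral of [expR (- (c * t))] is [4 * e], which is how every integral
    becomes of order [e]. *)
Let c := (4 * e)^-1.
Let c0 : 0 < c. Proof. by rewrite invr_gt0 mulr_gt0. Qed.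

Let integrable_bound (A B b : R) : 0 <= b ->
  mu.-integrable `]0, +oo[
    (EFin \o (fun t : R => A * expR (- (c * t)) + B * (expR (- t) * (1 + b * t)))).
Proof.
move=> b0; apply: integrableD_EFin => //; apply: integrableZl_EFin => //.
  exact: integrable_expRN.
exact: integrable_expRN_poly.
Qed.

Let Rintegral_bound (A B b : R) : 0 <= b ->
  \int[mu]_(t in `]0, +oo[) (A * expR (- (c * t)) + B * (expR (- t) * (1 + b * t)))
  = A * (4 * e) + B * (1 + b).
Proof.
move=> b0; have ie := integrable_expRN c0; have ik := integrable_expRN_poly b0.
rewrite RintegralD//; [|exact: integrableZl_EFin|exact: integrableZl_EFin].
by rewrite !RintegralZl// Rintegral_expRN// Rintegral_expRN_poly// invrK.
Qed.

Section one_variable.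
Context d (T : measurableType d) (P : probability T R).
Variables (Y : {RV P >-> R}) (phi : R -> R).
Hypothesis Ecos : forall t, \int[P]_w cos (t * Y w) = phi t.
Hypothesis Esin : forall t, \int[P]_w sin (t * Y w) = 0.
Hypothesis phi_le : forall t, 0 < t -> `|phi (t / e)| <= 2 * expR (- (c * t)) + 2 * e.

Lemma expectation_cauchy_le (x : R) :
  \int[P]_w (1 + ((Y w - x) / e) ^+ 2)^-1 <= 10 * e.
Proof.
rewrite (expectation_cauchy Ecos Esin).
(* The share 8 e comes from the exponential term of [phi_le], using [expR (- t) <= 1], and 2 e from
   its constant term integrated against [expR (- t)]. *)
rewrite (_ : 10 * e = 2 * (4 * e) + (2 * e) * (1 + 0)); last by ring.
rewrite -Rintegral_bound//; apply: le_Rintegral => //.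
- exact: (integrable_cauchy Ecos Esin).
- exact: integrable_bound.
move=> t; rewrite /= in_itv/= andbT => t0; rewrite mul0r addr0 mulr1.
have x1 : expR (- t) <= 1 by rewrite expR_le1 oppr_le0 ltW.
have x0 := expR_ge0 (- t).
rewrite (@le_trans _ _ (expR (- t) * `|phi (t / e)|))//.
  rewrite ler_wpM2l// (le_trans (ler_norm _))// normrM ler_piMr//.
  exact: cos_max.
rewrite (@le_trans _ _ (expR (- t) * (2 * expR (- (c * t)) + 2 * e)))//.
  by rewrite ler_wpM2l// phi_le.
rewrite mulrDr lerD//; last by rewrite mulrC.
by rewrite ler_piMl// mulr_ge0// expR_ge0.
Qed.

End one_variable.

Context d1 (T1 : measurableType d1) (P1 : probability T1 R) (Y1 : {RV P1 >-> R}).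
Context d2 (T2 : measurableType d2) (P2 : probability T2 R) (Y2 : {RV P2 >-> R}).
Variables (phi1 phi2 : R -> R).
Hypothesis Ecos1 : forall t, \int[P1]_w cos (t * Y1 w) = phi1 t.
Hypothesis Esin1 : forall t, \int[P1]_w sin (t * Y1 w) = 0.
Hypothesis Ecos2 : forall t, \int[P2]_w cos (t * Y2 w) = phi2 t.
Hypothesis Esin2 : forall t, \int[P2]_w sin (t * Y2 w) = 0.
Hypothesis phi1_le : forall t, 0 < t -> `|phi1 (t / e)| <= 2 * expR (- (c * t)) + 2 * e.
Hypothesis phi2_le : forall t, 0 < t -> `|phi2 (t / e)| <= 2 * expR (- (c * t)) + 2 * e.
Hypothesis phiB_le : forall t, 0 < t ->
  `|phi1 (t / e) - phi2 (t / e)| <= t * (6 * expR (- (c * t)) + 2 * e).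

(** The factor t in [phiB_le] cancels the [1 / t] of the kernel, and the sines are only bounded by
    1, so the estimate is uniform in [a] and [b]. *)
Lemma expectation_smooth_sign_le (a b : R) :
  `|\int[P1]_w (smooth_sign ((Y1 w - a) / e) - smooth_sign ((Y1 w - b) / e)) -
    \int[P2]_w (smooth_sign ((Y2 w - a) / e) - smooth_sign ((Y2 w - b) / e))|
  <= 56 * e.
Proof.
rewrite (expectation_smooth_sign Ecos1 Esin1) (expectation_smooth_sign Ecos2 Esin2).
have i1 := integrable_smooth_sign Ecos1 Esin1 a b e.
have i2 := integrable_smooth_sign Ecos2 Esin2 a b e.
rewrite -RintegralB//.
rewrite (le_trans (le_normr_Rintegral _ (integrableB_EFin _ i1 i2)))//.
(* Both terms of [phiB_le] are doubled by the difference of sines; the first uses that the kernel is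
   at most 1, the second that its mass is 2. *)
rewrite (_ : 56 * e = 12 * (4 * e) + (4 * e) * (1 + 1)); last by ring.
rewrite -Rintegral_bound//; apply: le_Rintegral => //.
- exact: integrable_norm (integrableB_EFin _ i1 i2).
- exact: integrable_bound.
move=> t; rewrite /= in_itv/= andbT => t0.
have k1 := expRN_1Dx_le1 t.
have k0 : 0 <= expR (- t) * (1 + t) by rewrite mulr_ge0 ?expR_ge0// addr_ge0// ltW.
rewrite -mulrBr -mulrBl !normrM normfV (gtr0_norm t0) mul1r.
rewrite -normrM (ger0_norm k0) -mulrA.
set s := sin _ - sin _.
have s2 : `|s| <= 2 by rewrite (le_trans (ler_normB _ _))// lerD ?sin_max.
apply: (@le_trans _ _ (expR (- t) * (1 + t) * ((6 * expR (- (c * t)) + 2 * e) * 2))).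
  rewrite ler_wpM2l// mulrA ler_pM ?mulr_ge0 ?invr_ge0 ?(ltW t0)//.
  by rewrite ler_pdivrMl// phiB_le.
have x0 := expR_ge0 (- (c * t)).
move: k0 k1 x0; move: (expR (- t) * (1 + t)) (expR (- (c * t))) => k x k0 k1 x0.
by have := e0; nra.
Qed.

Lemma cdf_increment_le (a b : R) :
  `|(fine (cdf Y1 b) - fine (cdf Y1 a)) - (fine (cdf Y2 b) - fine (cdf Y2 a))|
  <= 108 * e.
Proof.
have h := expectation_smooth_sign_le a b.
have := cdf_smooth_sign Y1 a b e0.
have := cdf_smooth_sign Y2 a b e0.
have := expectation_cauchy_le Ecos1 Esin1 phi1_le a.
have := expectation_cauchy_le Ecos1 Esin1 phi1_le b.
have := expectation_cauchy_le Ecos2 Esin2 phi2_le a.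
have := expectation_cauchy_le Ecos2 Esin2 phi2_le b.
move: h.
set E1 := (\int[P1]_w (_ - _)); set E2 := (\int[P2]_w (_ - _)).
set c1 := \int[P1]_w _; set c2 := \int[P2]_w _; set c3 := \int[P1]_w _; set c4 := \int[P2]_w _.
move: (_ - fine (cdf Y1 a)) (_ - fine (cdf Y2 a)) => F1 F2 h h1 h2 h3 h4.
have := @pi_ge2 R; move: (pi : R) => p p2.
rewrite !ler_norml => /andP[l1 l2] /andP[m1 m2].
move: h; rewrite ler_norml => /andP[n1 n2].
(* Here 216 = 56 + 4 * 40: four Poisson kernel expectations, each at most 10 e and weighted by 4.
   Dividing by pi >= 2 leaves 108. *)
have H : `|p * (F1 - F2)| <= 216 * e.
  by rewrite ler_norml; apply/andP; split; lra.
rewrite -ler_norml; have : 2 * `|F1 - F2| <= `|p * (F1 - F2)|.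
  by rewrite normrM ler_wpM2r// (le_trans p2)// ler_norm.
lra.
Qed.

End smoothing_inequality.

(** * Bounds on the rescaled characteristic functions *)

Lemma expRN_leV (R : realType) (v : R) : 0 <= v -> expR (- v) <= (1 + v)^-1.
Proof.
move=> v0; rewrite expRN lef_pV2 ?posrE ?expR_gt0 ?expR_ge1Dx//.
by rewrite ltr_pwDl.
Qed.

Section stable_estimates.
Context (R : realType) (alpha : R) (n : nat).
Hypothesis alpha1 : 1 < alpha.
Hypothesis n1 : (1 <= n)%N.
Let e : R := (n%:R `^ (1 / alpha))^-1.

Let alpha0 : 0 < alpha. Proof. exact: lt_trans alpha1. Qed.
Let nR1 : 1 <= n%:R :> R. Proof. by rewrite ler1n. Qed.
Let nR0 : 0 < n%:R :> R. Proof. by rewrite ltr0n. Qed.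

Lemma stable_scale_gt0 : 0 < e.
Proof. by rewrite invr_gt0 powR_gt0. Qed.

(** Since 1/alpha <= 1, errors of order 1/n are absorbed into [e]. *)
Let inv_n_le : n%:R^-1 <= e.
Proof.
rewrite lef_pV2 ?posrE ?powR_gt0// ler1_powR//.
by rewrite ler_pdivrMr// mul1r ltW.
Qed.

Let scale_powR t : 0 < t -> `|t / e| `^ alpha = n%:R * t `^ alpha.
Proof.
move=> t0; rewrite invrK gtr0_norm ?mulr_gt0 ?powR_gt0//.
rewrite powRM ?powR_ge0 ?(ltW t0)// -powRrM mul1r mulVf ?gt_eqF//.
by rewrite powRr1 ?(ltW nR0)// mulrC.
Qed.

Lemma stable_phi_scale t : 0 < t ->
  stable_phi alpha (t / e) = expR (- (n%:R * t `^ alpha)).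
Proof. by move=> t0; rewrite /stable_phi scale_powR. Qed.

Lemma stable_phi_n_scale t : 0 < t ->
  stable_phi_n alpha n (t / e) = expR (n%:R * (expR (- t `^ alpha) - 1)).
Proof.
move=> t0; rewrite /stable_phi_n stable_phi_scale// -expRM; congr (expR (_ * (expR _ - 1))).
by field; rewrite gt_eqF.
Qed.

(** From exp(-v) - 1 >= -v. It fixes the sign of the difference and transfers upper bounds from
    [stable_phi_n] to [stable_phi]. *)
Lemma stable_phi_le_phi_n t : 0 < t ->
  stable_phi alpha (t / e) <= stable_phi_n alpha n (t / e).
Proof.
move=> t0; rewrite stable_phi_scale// stable_phi_n_scale// ler_expR -mulrN ler_wpM2l//.
by have := expR_ge1Dx (- t `^ alpha); lra.
Qed.

(** As alpha > 1, n t^alpha = (t/e)^alpha is at least t/e - 1, trivially so when t/e < 1. This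
    trades the power for a linear exponent, at the cost of a factor exp(1/4). *)
Let expR_quarter_le t : 0 < t -> 
  expR (- (n%:R * t `^ alpha / 4)) <= 4 / 3 * expR (- ((4 * e)^-1 * t)).
Proof.
move=> t0.
have te0 : 0 < t / e by rewrite divr_gt0// stable_scale_gt0.
have h : t / e - 1 <= n%:R * t `^ alpha.
  rewrite -scale_powR// gtr0_norm//; have [te1|te1] := leP 1 (t / e).
    have := le1r_powR te1 (ltW alpha1); lra.
  by rewrite (@le_trans _ _ 0) ?powR_ge0//; lra.
apply: (@le_trans _ _ (expR (1 / 4) * expR (- ((4 * e)^-1 * t)))).
  rewrite -expRD ler_expR.
  have -> : (4 * e)^-1 * t = (t / e) / 4 by field; rewrite gt_eqF// stable_scale_gt0.
  lra.
(* Passing to inverses, exp(1/4) <= 4/3 follows from exp(-1/4) >= 1 - 1/4. *)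
rewrite ler_wpM2r ?expR_ge0// -[leLHS]invrK -expRN -[leRHS]invrK.
rewrite lef_pV2 ?posrE ?expR_gt0 ?invr_gt0//.
by rewrite (le_trans _ (expR_ge1Dx _))//; lra.
Qed.

(** For v in [0, 1], exp(-v) <= 1 / (1 + v) <= 1 - v/2. *)
Let phi_n_le_small t : 0 < t <= 1 ->
  stable_phi_n alpha n (t / e) <= expR (- (n%:R * t `^ alpha / 2)).
Proof.
move=> /andP[t0 t1]; rewrite stable_phi_n_scale// ler_expR.
have v0 : 0 <= t `^ alpha by exact: powR_ge0.
have v1 : t `^ alpha <= 1.
  by rewrite (le_trans _ t1)// ge1r_powR ?t0// ltW.
have : expR (- t `^ alpha) <= 1 - t `^ alpha / 2.
  rewrite (le_trans (expRN_leV v0))// -[leLHS]mul1r ler_pdivrMr ?ltr_pwDl//.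
  by nra.
by move=> h; rewrite -mulrA -mulrN ler_wpM2l//; lra.
Qed.

(** As t grows, [stable_phi_n] tends to exp(-n) and not to 0, hence a constant bound: for t >= 1 it
    is at most exp(-n/2) <= 2/n. *)
Let phi_n_le_large t : 1 <= t -> stable_phi_n alpha n (t / e) <= 2 * e.
Proof.
move=> t1; have t0 : 0 < t by lra.
rewrite stable_phi_n_scale//.
have v1 : 1 <= t `^ alpha by rewrite (le_trans t1)// le1r_powR// ltW.
have hv : expR (- t `^ alpha) <= 2^-1.
  have w0 : 0 < 1 + t `^ alpha by lra.
  have v0 : 0 <= t `^ alpha by lra.
  rewrite (le_trans (expRN_leV v0))// lef_pV2 ?posrE//; lra.
apply: (@le_trans _ _ (expR (- (n%:R / 2)))).
  by rewrite ler_expR -mulrN ler_wpM2l//; lra.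
rewrite (le_trans (expRN_leV _)) ?divr_ge0//.
apply: (@le_trans _ _ (2 * n%:R^-1)); last by rewrite ler_wpM2l.
by rewrite -[leRHS]invrK invfM invrK lef_pV2 ?posrE ?mulr_gt0//; lra.
Qed.

Lemma stable_phi_n_le t : 0 < t ->
  `|stable_phi_n alpha n (t / e)| <= 2 * expR (- ((4 * e)^-1 * t)) + 2 * e.
Proof.
move=> t0; rewrite ger0_norm ?expR_ge0//.
have x0 := expR_ge0 (- ((4 * e)^-1 * t)).
have [t1|t1] := leP 1 t.
  by have := phi_n_le_large t1; lra.
have t01 : 0 < t <= 1 by rewrite t0 ltW.
have v0 : 0 <= n%:R * t `^ alpha by rewrite mulr_ge0 ?powR_ge0.
have := phi_n_le_small t01; have := expR_quarter_le t0.
have : expR (- (n%:R * t `^ alpha / 2)) <= expR (- (n%:R * t `^ alpha / 4)).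
  by rewrite ler_expR; lra.
by have := stable_scale_gt0; lra.
Qed.

Lemma stable_phi_le t : 0 < t ->
  `|stable_phi alpha (t / e)| <= 2 * expR (- ((4 * e)^-1 * t)) + 2 * e.
Proof.
move=> t0; apply: le_trans (stable_phi_n_le t0).
by rewrite !ger0_norm ?expR_ge0 ?stable_phi_le_phi_n.
Qed.

Lemma stable_phiB_le t : 0 < t ->
  `|stable_phi_n alpha n (t / e) - stable_phi alpha (t / e)|
    <= t * (6 * expR (- ((4 * e)^-1 * t)) + 2 * e).
Proof.
move=> t0; have le12 := stable_phi_le_phi_n t0.
rewrite ger0_norm ?subr_ge0//.
have x0 := expR_ge0 (- ((4 * e)^-1 * t)).
have e0 := stable_scale_gt0.
have [t1|t1] := leP 1 t.
  have := phi_n_le_large t1; have : 0 <= stable_phi alpha (t / e) by exact: expR_ge0.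
  by nra.
have t01 : 0 < t <= 1 by rewrite t0 ltW.
have v0 : 0 <= t `^ alpha by exact: powR_ge0.
have vt : t `^ alpha <= t by rewrite ge1r_powR// ltW.
(* [D] is the logarithm of the ratio of [stable_phi_n] to [stable_phi], so their difference is
   [stable_phi_n] times 1 - exp(-D) <= D. *)
pose D := n%:R * (expR (- t `^ alpha) - 1) + n%:R * t `^ alpha.
have D0 : D <= n%:R * t `^ alpha * t.
  rewrite /D -mulrDr -mulrA ler_wpM2l//.
  (* With v = t^alpha <= t, (1 + v) (1 - v + v t) >= 1 because v t >= v^2. *)
  have : expR (- t `^ alpha) <= 1 - t `^ alpha + t `^ alpha * t.
    rewrite (le_trans (expRN_leV v0))// -[leLHS]mul1r ler_pdivrMr ?ltr_pwDl//.
    by nra.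
  by lra.
have step : stable_phi_n alpha n (t / e) - stable_phi alpha (t / e)
    <= D * stable_phi_n alpha n (t / e).
  rewrite stable_phi_scale// stable_phi_n_scale//.
  have -> : - (n%:R * t `^ alpha) = n%:R * (expR (- t `^ alpha) - 1) + - D by rewrite /D; ring.
  rewrite expRD; have := expR_ge1Dx (- D).
  have := expR_gt0 (n%:R * (expR (- t `^ alpha) - 1)).
  by nra.
have u0 : 0 <= n%:R * t `^ alpha by rewrite mulr_ge0.
rewrite (le_trans step)//.
apply: (@le_trans _ _ (n%:R * t `^ alpha * t * expR (- (n%:R * t `^ alpha / 2)))).
  apply: (@le_trans _ _ (n%:R * t `^ alpha * t * stable_phi_n alpha n (t / e))).
    by rewrite ler_wpM2r// expR_ge0.
  by rewrite ler_wpM2l ?phi_n_le_small// mulr_ge0// ltW.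
have := expR_quarter_le t0.
(* With u = n t^alpha, exp(-u/2) is split into two factors exp(-u/4): one absorbs u, as u exp(-u/4)
   <= 4, and the other is bounded by [expR_quarter_le]. The constant is 4 * 4/3 <= 6. *)
rewrite (_ : n%:R * t `^ alpha / 2 = n%:R * t `^ alpha / 4 + n%:R * t `^ alpha / 4); last first.
  by field.
rewrite opprD expRD.
have : n%:R * t `^ alpha / 4 * expR (- (n%:R * t `^ alpha / 4)) <= 1.
  by rewrite expRN ler_pdivrMr ?expR_gt0// mul1r (le_trans _ (expR_ge1Dx _))//; lra.
move: (expR_ge0 (- (n%:R * t `^ alpha / 4))) u0 x0.
move: (expR (- ((4 * e)^-1 * t))) (n%:R * t `^ alpha)
  (expR (- (n%:R * t `^ alpha / 4))) => x u y y0 u0 x0 uy yx.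
have uyy : u * (y * y) <= 4 * y.
  have -> : u * (y * y) = 4 * (u / 4 * y) * y by field.
  by rewrite ler_wpM2r//; lra.
have -> : u * t * (y * y) = t * (u * (y * y)) by ring.
by rewrite ler_wpM2l ?(ltW t0)//; lra.
Qed.

End stable_estimates.

(** * From increments to the Kolmogorov distance *)

Lemma char_fun_expectation (R : realType) d (T : measurableType d)
    (P : probability T R) (X : {RV P >-> R}) (phi : R -> R) :
  (forall t, char_fun X t = (phi t)%:C) ->
  (forall t, \int[P]_w cos (t * X w) = phi t) /\
  (forall t, \int[P]_w sin (t * X w) = 0).
Proof.
move=> h; split=> t; have := h t; rewrite /char_fun unlock => -[hc hs].
  exact: hc.
exact: hs.
Qed.

Lemma fine_cdf_cvgNy0 (R : realType) d (T : measurableType d)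
    (P : probability T R) (X : {RV P >-> R}) :
  fine (cdf X a) @[a --> -oo] --> (0 : R).
Proof. exact: (fine_cvg (cvg_cdfNy0 X)). Qed.

Unset Implicit Arguments.
Theorem theorem4p5 (R : realType) (alpha : R) (halpha : 1 < alpha < 2) :
  exists C : R, 0 < C /\
  forall (d : measure_display) (T : measurableType d) (P : probability T R)
    (X : {RV P >-> R})
    (dn : nat -> measure_display) (Tn : forall n, measurableType (dn n))
    (Pn : forall n, probability (Tn n) R) (Xn : forall n, {RV (Pn n) >-> R}),
  symmetric_stable alpha X ->
  (forall t : R, char_fun X t = (stable_phi alpha t)%:C) ->
  (forall n : nat, (1 <= n)%N -> compound_poisson (Xn n)) ->
  (forall n : nat, (1 <= n)%N ->
     forall t : R, char_fun (Xn n) t = (stable_phi_n alpha n t)%:C) ->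
  forall n : nat, (1 <= n)%N ->
    kolmogorov_dist (Xn n) X <= C / n%:R `^ (1 / alpha).
Proof.
have /andP[alpha1 _] := halpha.
(* The witness is the constant of [cdf_increment_le]. *)
exists 108; split=> // d T P X dn Tn Pn Xn _ chX _ chXn n n1.
have [EcosX EsinX] := char_fun_expectation chX.
have [EcosXn EsinXn] := char_fun_expectation (chXn n n1).
apply: ge_sup; first by exists `|fine (cdf (Xn n) 0) - fine (cdf X 0)|, 0.
move=> _ [x _ <-].
have incr := cdf_increment_le (stable_scale_gt0 alpha n1) EcosXn EsinXn EcosX EsinX
  (stable_phi_n_le alpha1 n1) (stable_phi_le alpha1 n1) (stable_phiB_le alpha1 n1).
(* For [a] far enough to the left both distribution functions are at most r/2 at [a], so replacing
   increments by values at [x] costs at most r. *)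
apply/ler_addgt0Pr => r r0.
have := fine_cdf_cvgNy0 X; move=> /cvgr0_norm_le /(_ (r / 2) _) cX.
have := fine_cdf_cvgNy0 (Xn n); move=> /cvgr0_norm_le /(_ (r / 2) _) cXn.
have r2 : 0 < r / 2 by rewrite divr_gt0.
near (ninfty_nbhs R) => a.
have h1 : `|fine (cdf X a)| <= r / 2 by near: a; exact: cX.
have h2 : `|fine (cdf (Xn n) a)| <= r / 2 by near: a; exact: cXn.
have := incr a x; move: h1 h2.
move: (fine (cdf X a)) (fine (cdf (Xn n) a)) (fine (cdf X x)) (fine (cdf (Xn n) x)).
move=> u v F G; rewrite !ler_norml => /andP[? ?] /andP[? ?] /andP[? ?].
apply/andP; split; lra.
Unshelve. all: by end_near. Qed.
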